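(* For all positive integers $k$ and $n$, and for every graph $G$ on $n$ vertices, the following holds: if $\kappa(G) \geq 10^{10}k^3 \log n$, then there exists a spanning bipartite subgraph $H \subseteq G$ such that $\kappa(H) \geq k$.
   Context: All graphs are finite and simple. A graph $G$ is $k$-connected if one must remove at least $k$ vertices from $V(G)$ in order to disconnect it or to leave only a single vertex; $\kappa(G)$ denotes the vertex-connectivity of $G$, i.e. the largest $k$ such that $G$ is $k$-connected. A spanning subgraph of $G$ has vertex set $V(G)$. Here $\log$ denotes the logarithm to base $2$.
   Formalization: The formal statement assumes n ≥ 2: for n = 1 the claim fails for every k, since the one-vertex graph has κ = 0 ≥ 10^10 k^3 log 1 = 0 but its only spanning subgraph has κ = 0 < k. *)

(* Defs.v *)
From mathcomp Require Import all_boot all_order all_algebra.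
From mathcomp Require Import reals exp.

Set Implicit Arguments.
Unset Strict Implicit.
Unset Printing Implicit Defensive.

Import GRing.Theory Num.Theory.

Section Graphs.
Variable T : finType.
Implicit Types (e h : rel T) (S A : {set T}).

Definition simple_graph e : Prop := symmetric e /\ irreflexive e.

(* The vertex set is the whole type [T], so a graph [h] on [T] with
   [subrel h e] is automatically spanning in [e]. *)
Definition spanning_subgraph h e : Prop := simple_graph h /\ subrel h e.

Definition bipartite e : Prop :=
  exists A, forall x y, e x y -> (x \in A) != (y \in A).

Definition del_vertices e S : rel T :=
  [rel x y | [&& x \notin S, y \notin S & e x y]].

(* [G - S] has two vertices not joined by a path; [del_vertices] keeps the
   carrier [T], so both endpoints must be required to lie outside [S]. *)
Definition disconnects e S : bool :=
  [exists x, exists y,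
    [&& x \notin S, y \notin S & ~~ connect (del_vertices e S) x y]].

Definition kconnected k e : bool :=
  [forall S : {set T}, disconnects e S || (#|~: S| == 1) ==> (k <= #|S|)].

(* On a nonempty [T], deleting all vertices but one shows that a k-connected
   graph has k < #|T|, so the maximum over k < #|T| is unrestricted
   (see [kconnected_kappa]). *)
Definition kappa e : nat := \max_(k < #|T| | kconnected k e) k.

Lemma kconnected0 e : kconnected 0 e.
Proof. by apply/forallP => S; apply/implyP. Qed.

Lemma kconnectedW j k e : j <= k -> kconnected k e -> kconnected j e.
Proof.
move=> jk /forallP ek; apply/forallP => S; apply/implyP => eS.
by apply: leq_trans jk _; apply: (implyP (ek S)).
Qed.

Lemma kconnected_lt_card k e : 0 < #|T| -> kconnected k e -> k < #|T|.
Proof.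
move=> /card_gt0P[x _] /forallP/(_ (~: [set x])).
rewrite setCK cards1 eqxx orbT /= => /leq_ltn_trans; apply.
by rewrite -(cardsC [set x]) cards1 add1n.
Qed.

Lemma kconnected_kappa k e : 0 < #|T| -> kconnected k e = (k <= kappa e).
Proof.
move=> T0; apply/idP/idP => [ek|].
  pose i := Ordinal (kconnected_lt_card T0 ek).
  exact: (@leq_bigmax_cond _ _ (fun i : 'I_#|T| => i : nat) i).
move=> /kconnectedW; apply; rewrite /kappa.
by elim/big_ind: _ => [|x y ex ey|//]; [exact: kconnected0|rewrite /maxn; case: ifP].
Qed.

End Graphs.

Definition log2 (R : realType) (x : R) : R := (ln x / ln 2)%R.

(* Main.v *)
Require Import Defs.
From mathcomp Require Import all_boot all_order all_algebra.
From mathcomp Require Import reals exp.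
From mathcomp Require Import boolp zify.

(* Take a 2-colouring of the vertices and a partition into pieces, each of which
   is a single vertex or has at least s = 100 k^2 L vertices (L = ceil(log2 n))
   and is k-connected through its bichromatic edges, with as few pieces as
   possible; suppose that there are at least two of them.  Flipping the colours
   on a whole piece keeps it k-connected.  By minimality two pieces, one of them
   large, cannot be merged after a flip, so at most 2k vertices cover the edges
   between them.  Since G is highly connected, every piece, even after deletion
   of fewer than k vertices, therefore sends edges to many other pieces.  Random
   flips keep a constant fraction of these adjacencies bichromatic, for all
   pieces and all deleted sets at once.  Now, if a family of pieces is not
   k-connected, a separator S splits the pieces missed by S into two nonempty
   groups; pass to the smaller one, whose members lose fewer than k adjacent
   pieces, namely those hit by S.  After at most L halvings a family of at least
   two pieces has a k-connected union of size at least s, and merging it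
   contradicts minimality. *)

Set Implicit Arguments.
Unset Strict Implicit.
Unset Printing Implicit Defensive.

(** * Counting flips: a tail bound and a union bound *)

Lemma leq_card_bigcup (I J : finType) (A : {set I}) (F : I -> {set J}) m :
  (forall i, i \in A -> #|F i| <= m) -> #|\bigcup_(i in A) F i| <= #|A| * m.
Proof.
move=> Fm; rewrite -sum_nat_const; elim/big_rec2: _ => [|i n U iA Un].
  by rewrite cards0.
by apply: leq_trans (leq_card_setU _ _) _; rewrite leq_add ?Fm.
Qed.

Lemma leq_expl m n e : m <= n -> m ^ e <= n ^ e.
Proof. by move=> mn; case: e => // e; rewrite leq_exp2r. Qed.

(** Exponential moments: let [x] weigh 2 to the number of its mismatches on [N]. The total weight is
    [3 ^ #|N| * 2 ^ #|~: N|], while an [x] with fewer than [d] matches weighs at least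
    [2 ^ (#|N| - d)]. *)
Lemma card_few_matches (I : finType) (N : {set I}) (b : I -> bool) (d : nat) :
  8 * d <= #|N| ->
  #|[set x : {ffun I -> bool} | #|[set j in N | x j == b j]| < d]| * 4 ^ d
    <= 2 ^ #|I|.
Proof.
move=> dN; set bad := [set x | _].
pose w j (y : bool) := if j \in N then (if y == b j then 1 else 2) else 1.
have wE : \sum_(x : {ffun I -> bool}) \prod_j w j (x j)
          = 3 ^ #|N| * 2 ^ #|~: N|.
  rewrite -(bigA_distr_bigA w) (bigID (mem N)) /=; congr muln.
    rewrite -prod_nat_const.
    by apply: eq_bigr => j jN; rewrite big_bool /w jN; case: (b j).
  rewrite -prod_nat_const; apply: eq_big => [j|j jN]; first by rewrite in_setC.
  by rewrite big_bool /w (negbTE jN).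
have wbad x : x \in bad -> 2 ^ (#|N| - d) <= \prod_j w j (x j).
  rewrite inE => xd; rewrite (bigID (mem N)) /= mulnC big1 ?mul1n; last first.
    by move=> j jN; rewrite /w (negbTE jN).
  rewrite (bigID (fun j => x j == b j)) /= big1 ?mul1n; last first.
    by move=> j /andP[jN jb]; rewrite /w jN jb.
  rewrite (eq_bigr (fun=> 2)); last first.
    by move=> j /andP[jN jb]; rewrite /w jN (negbTE jb).
  rewrite big_const iter_muln_1 leq_pexp2l //.
  have := cardsID [set j in N | x j == b j] N.
  set m := #|_ :&: _|; set q := #|_ :\: _| => mq.
  have -> : #|[pred j | (j \in N) && (x j != b j)]| = q.
    by apply: eq_card => j; rewrite !inE; case: (j \in N); case: (x j == b j).
  have : m <= #|[set j in N | x j == b j]| by exact/subset_leq_card/subsetIr.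
  by move=> mle; rewrite leq_subLR -mq leq_add2r (leq_trans mle (ltnW xd)).
have badw : #|bad| * 2 ^ (#|N| - d) <= 3 ^ #|N| * 2 ^ #|~: N|.
  rewrite -wE -sum_nat_const [leqRHS](bigID (mem bad)) /=.
  by apply: leq_trans (leq_addr _ _); exact: leq_sum.
have {badw} := leq_mul badw (leqnn (2 ^ #|N|)).
rewrite -[in leqRHS]mulnA -expnD [#|~: N| + _]addnC cardsC.
rewrite -mulnA -expnD.
have := subnK dN; move: (#|N| - _) => a Na; rewrite -Na.
have -> : a + 8 * d - d + (a + 8 * d) = 2 * d + (2 * a + 13 * d) by lia.
rewrite expnD mulnA (expnM 2 2 d) => badw.
rewrite -(@leq_pmul2r (2 ^ (2 * a + 13 * d))) ?expn_gt0 //.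
apply: leq_trans badw _; rewrite mulnC leq_mul2l; apply/orP; right.
(* It remains that [3 ^ a <= 4 ^ a] and [3 ^ 8 <= 2 ^ 13]; the latter is why the ratio 8
   suffices. *)
rewrite expnD [leqRHS]expnD (expnM 3 8) (expnM 2 2) (expnM 2 13).
by rewrite leq_mul ?leq_expl.
Qed.

(** Union bound: each relevant [t] excludes at most one in [4 ^ D] functions. *)
Lemma exists_many_matches (I J : finType) (N : J -> {set I})
    (b : J -> I -> bool) (d : J -> nat) (D : nat) :
  #|J| < 4 ^ D ->
  exists x : {ffun I -> bool}, forall t, D <= d t -> 8 * d t <= #|N t| ->
    d t <= #|[set j in N t | x j == b t j]|.
Proof.
move=> JD; pose M t x := [set j in N t | x j == b t j].
pose ok t := (D <= d t) && (8 * d t <= #|N t|).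
pose bad t := [set x : {ffun I -> bool} | #|M t x| < d t].
suff /subsetPn[x _ xP] : ~~ (setT \subset \bigcup_(t | ok t) bad t).
  exists x => t Dd dN; rewrite leqNgt; apply: contra xP => xt.
  by apply/bigcupP; exists t; rewrite /ok ?Dd // inE.
apply/negP => /subset_leq_card; rewrite cardsT card_ffun card_bool.
apply/negP; rewrite -ltnNge -(@ltn_pmul2r (4 ^ D)) ?expn_gt0 //.
apply: (@leq_ltn_trans (#|J| * 2 ^ #|I|)); last first.
  by rewrite mulnC ltn_pmul2l ?expn_gt0.
apply: (@leq_trans ((\sum_(t | ok t) #|bad t|) * 4 ^ D)).
  rewrite leq_mul2r; apply/orP; right.
  elim/big_rec2: _ => [|t m U _ Um]; first by rewrite cards0.
  by rewrite (leq_trans (leq_card_setU _ _)) // leq_add2l.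
rewrite big_distrl /= -sum_nat_const.
rewrite [leqRHS](bigID ok) /= (leq_trans _ (leq_addr _ _)) //.
apply: leq_sum => t /andP[Dd dN]; apply: leq_trans (card_few_matches (b t) dN).
by rewrite leq_mul2l leq_pexp2l ?orbT.
Qed.

(** * Connectivity inside a vertex subset *)

Section Connectivity.
Variable T : finType.
Implicit Types (h : rel T) (S U V A : {set T}) (k : nat).

(** Stated with edge-closed sets instead of paths, so that a failure directly yields one side [A] of
    a separation. *)
Definition connected_in h U := forall A x y,
  (forall a b, a \in U -> b \in U -> h a b -> a \in A -> b \in A) ->
  x \in U -> y \in U -> x \in A -> y \in A.

(* There is no lower bound on [#|U|], so singletons are k-connected for
   every k. *)
Definition kconnected_in k h U := forall S, #|S| < k -> connected_in h (U :\: S).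

Lemma connected_in_eq h h' U : {in U &, h =2 h'} ->
  connected_in h U -> connected_in h' U.
Proof.
move=> hh' hU A x y clA; apply: hU => a b aU bU hab.
by apply: clA => //; rewrite -hh'.
Qed.

Lemma connected_inU h U V u v : symmetric h -> connected_in h U ->
  connected_in h V -> u \in U -> v \in V -> h u v -> connected_in h (U :|: V).
Proof.
move=> h_sym hU hV uU vV huv A x y clA xUV yUV xA.
have clU a b : a \in U -> b \in U -> h a b -> a \in A -> b \in A.
  by move=> aU bU; apply: clA; rewrite inE ?aU ?bU.
have clV a b : a \in V -> b \in V -> h a b -> a \in A -> b \in A.
  by move=> aV bV; apply: clA; rewrite inE ?aV ?bV orbT.
have uvA : (u \in A) = (v \in A).
  by apply/idP/idP; apply: clA; rewrite ?inE ?uU ?vV ?orbT // h_sym.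
have uA : u \in A.
  case/setUP: xUV => [xU|xV]; first exact: hU clU xU uU xA.
  by rewrite uvA; exact: hV clV xV vV xA.
case/setUP: yUV => [yU|yV]; first exact: hU clU uU yU uA.
by apply: (hV _ _ _ clV vV yV); rewrite -uvA.
Qed.

Lemma kconnected_in_eq k h h' U : {in U &, h =2 h'} ->
  kconnected_in k h U -> kconnected_in k h' U.
Proof.
move=> hh' hU S /hU; apply: connected_in_eq => x y /setDP[xU _] /setDP[yU _].
exact: hh'.
Qed.

Lemma kconnected_in_le1 k h U : #|U| <= 1 -> kconnected_in k h U.
Proof.
move=> U1 S _ A x y _ /setDP[xU _] /setDP[yU _].
by have /card_le1_eqP/(_ x y xU yU) -> := U1.
Qed.

Lemma kconnected_inU k h U V : symmetric h ->
  kconnected_in k h U -> kconnected_in k h V ->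
  (forall S, #|S| < k -> ~~ (U \subset S) -> ~~ (V \subset S) ->
    exists u v, [/\ u \in U :\: S, v \in V :\: S & h u v]) ->
  kconnected_in k h (U :|: V).
Proof.
move=> h_sym hU hV UV S Sk; rewrite setDUl.
have [US|US] := boolP (U \subset S).
  by move: (US); rewrite -setD_eq0 => /eqP->; rewrite set0U; exact: hV.
have [VS|VS] := boolP (V \subset S).
  by move: (VS); rewrite -setD_eq0 => /eqP->; rewrite setU0; exact: hU.
have [u [v [uU vV huv]]] := UV S Sk US VS.
by apply: (connected_inU h_sym (hU S Sk) (hV S Sk) uU vV huv).
Qed.

(** The bound [k < #|T|] handles cuts that leave a single vertex; for the others, the closed set is
    what [x] reaches. *)
Lemma kconnected_in_setT k h : k < #|T| -> kconnected_in k h setT ->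
  kconnected k h.
Proof.
move=> kT hT; apply/forallP => S; apply/implyP; rewrite leqNgt => hS.
apply/negP => Sk; case/orP: hS => [|/eqP S1]; last first.
  by have := cardsC S; rewrite S1; lia.
case/existsP => x /existsP[y /and3P[xS yS /negP]]; apply.
suff: y \in [set z | connect (del_vertices h S) x z] by rewrite inE.
apply: (hT S Sk _ x); rewrite ?inE ?xS ?yS ?connect0 // => a b.
rewrite !inE !andbT => aS bS hab /connect_trans.
by apply; apply: connect1; apply/and3P.
Qed.

Lemma kconnected_cut k h S A x y : kconnected k h ->
  x \notin S -> y \notin S -> x \in A -> y \notin A ->
  (forall a b, a \notin S -> b \notin S -> h a b -> a \in A -> b \in A) ->
  k <= #|S|.
Proof.
move=> /forallP/(_ S)/implyP hk xS yS xA yA clA; apply: hk.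
apply/orP; left; apply/existsP; exists x; apply/existsP; exists y.
rewrite xS yS /=; apply/negP => /connectP[q]; elim: q x xS xA => [|z q IH] x xS xA.
  by move=> _ /= yx; rewrite yx xA in yA.
move=> /= /andP[/and3P[_ zS xz]]; apply: IH => //; exact: clA xz xA.
Qed.

(** Deleting the neighbours of [x] leaves it alone or cut off from another vertex. *)
Lemma kconnected_degree k h x : irreflexive h -> kconnected k h ->
  k <= #|[set y | h x y]|.
Proof.
move=> h_irr hk; set S := [set y | h x y].
have [/eqP|] := boolP (~: S == [set x]).
  move/forallP/(_ S)/implyP: hk => hk S1; apply: hk.
  by rewrite S1 cards1 eqxx orbT.
have xS : x \notin S by rewrite inE h_irr.
rewrite eqEsubset sub1set [x \in _]inE xS andbT => /subsetPn[y].
rewrite !inE => xy yx.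
apply: (@kconnected_cut _ _ _ [set x] x y hk) => //; rewrite ?inE //.
by move=> a b _; rewrite !inE => xb hab /eqP ax; rewrite -ax hab in xb.
Qed.

End Connectivity.

(** * Families of pieces and the halving argument *)

Section Pieces.
Variables (T : finType) (p : T -> T).
Implicit Types (h : rel T) (S A C : {set T}) (k : nat).

(* The partition of the vertex set is encoded by a labelling [p]; its classes
   are the nonempty pieces. *)
Definition piece i := [set v | p v == i].

Definition pieces_union C := [set v | p v \in C].

(** Only the endpoint in piece [i] must avoid [S]; pieces meeting [S] are discounted in
    [closed_side]. *)
Definition touched h S i := [set j | (j != i) &&
  [exists u, exists w, [&& p u == i, u \notin S, p w == j & h u w]]].

Definition rich k h C (f : T -> nat) := forall i S, i \in C ->
  #|S| < k -> ~~ (piece i \subset S) -> f i <= #|C :&: touched h S i|.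

Lemma touchedP h S i j : reflect
  (j != i /\ exists u w, [/\ p u = i, u \notin S, p w = j & h u w])
  (j \in touched h S i).
Proof.
rewrite inE; apply: (iffP andP) => -[ji].
  move=> /existsP[u /existsP[w /and4P[/eqP pu uS /eqP pw huw]]].
  by split=> //; exists u, w.
move=> [u [w [pu uS pw huw]]]; split=> //; apply/existsP; exists u.
by apply/existsP; exists w; rewrite pu pw !eqxx uS.
Qed.

(** Each piece minus [S] is connected, so it lies on one side of [A]. A piece of [C] adjacent to a
    member of [C'] is therefore in [C'] or meets [S]; fewer than [k] pieces meet [S], which costs
    one [k]. *)
Lemma closed_side k h C S A (f : T -> nat) x l :
  (forall i, kconnected_in k h (piece i)) ->
  rich k h C (fun i => f i + k * l.+1) ->
  #|S| < k -> x \in pieces_union C :\: S -> x \in A ->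
  (forall a b, a \in pieces_union C :\: S -> b \in pieces_union C :\: S ->
    h a b -> a \in A -> b \in A) ->
  let C' := [set i in C | (piece i \subset A) && [disjoint piece i & S]] in
  C' != set0 /\ rich k h C' (fun i => f i + k * l).
Proof.
move=> hp hC Sk xU xA clA C'; pose pS := [set p v | v in S].
have pSk : #|pS| < k by apply: leq_ltn_trans Sk; exact: leq_imset_card.
have side v w : v \in pieces_union C :\: S -> w \in pieces_union C :\: S ->
    p v = p w -> v \in A -> w \in A.
  move=> vU wU pvw; apply: (hp (p v) S Sk A v w) => [a b||].
  - rewrite !inE => /andP[aS /eqP pa] /andP[bS /eqP pb]; apply: clA.
      by rewrite !inE aS pa; move: vU; rewrite !inE => /andP[].
    by rewrite !inE bS pb; move: vU; rewrite !inE => /andP[].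
  - by move: vU; rewrite !inE => /andP[->]; rewrite eqxx.
  - by move: wU; rewrite !inE => /andP[->]; rewrite pvw eqxx.
have step u w : u \in pieces_union C :\: S -> u \in A -> h u w ->
    p w \in C -> p w \notin pS -> p w \in C'.
  move=> uU uA huw pwC pwS.
  have nS v : p v = p w -> v \notin S.
    by move=> pv; apply: contra pwS => vS; apply/imsetP; exists v.
  have wU : w \in pieces_union C :\: S by rewrite !inE nS // pwC.
  have wA : w \in A by apply: clA uU wU huw uA.
  rewrite inE pwC /=; apply/andP; split; last first.
    rewrite disjoint_subset; apply/subsetP => v; rewrite !inE => /eqP pv.
    exact: nS.
  apply/subsetP => v; rewrite inE => /eqP pv; apply: (side w) => //.
  by rewrite !inE nS // pv pwC.
have pxC : p x \in C by move: xU; rewrite !inE => /andP[].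
have xS : x \notin S by move: xU; rewrite inE => /andP[].
split.
  (* The piece of [x] may meet [S] itself, so a neighbouring piece disjoint from [S] is found
     instead. *)
  have /(hC _ S pxC Sk) : ~~ (piece (p x) \subset S).
    by apply/subsetPn; exists x; rewrite ?inE.
  set N := _ :&: _ => xN.
  have /subsetPn[j] : ~~ (N \subset pS).
    apply/negP => /subset_leq_card; rewrite leqNgt (leq_trans pSk) //.
    by apply: leq_trans xN; nia.
  rewrite inE => /andP[jC /touchedP[_ [u [w [pu uS pw huw]]]]] jS.
  apply/set0Pn; exists j; rewrite -pw; apply: (step u); rewrite ?pw //.
    by rewrite !inE uS pu.
  by apply: (side x); rewrite ?pu // !inE uS pu.
move=> i S'; rewrite inE => /and3P[iC /subsetP iA iS] S'k iS'.
have iCS := hC i S' iC S'k iS'.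
suff NN : C :&: touched h S' i \subset (C' :&: touched h S' i) :|: pS.
  have := leq_trans iCS (leq_trans (subset_leq_card NN) (leq_card_setU _ _)).
  by nia.
apply/subsetP => j; rewrite inE => /andP[jC jt].
have [jS|jS] := boolP (j \in pS); first by rewrite inE jS orbT.
rewrite inE (negbTE jS) orbF inE jt andbT.
have /touchedP[_ [u [w [pu uS' pw huw]]]] := jt.
rewrite -pw; apply: (step u); rewrite ?pw //; last by apply: iA; rewrite inE pu.
rewrite !inE pu iC andbT; apply: contraTN iS => uS.
by apply/pred0Pn; exists u; rewrite !inE pu eqxx.
Qed.

(** Induction on [l]: a separation yields two disjoint subfamilies, one of them with at most half
    the members. The slack [k * l] pays for [l] such steps. *)
Lemma kconnected_subfamily k h (f : T -> nat) l C : symmetric h -> 0 < k ->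
  (forall i, kconnected_in k h (piece i)) ->
  C != set0 -> C \subset [set p v | v : T] -> #|C| <= 2 ^ l ->
  (forall i, k < f i) -> rich k h C (fun i => f i + k * l) ->
  exists C', [/\ C' \subset C, C' != set0, rich k h C' f &
    kconnected_in k h (pieces_union C')].
Proof.
move=> h_sym k_gt0 hp + + + kf; elim: l C => [|l IH] C C0 CT Cl hC.
  (* A lone piece cannot be rich, since [touched] excludes the piece itself. *)
  have /set0Pn[i iC] := C0; exfalso.
  have /hC : #|set0 : {set T}| < k by rewrite cards0.
  move=> /(_ i iC); rewrite subset0.
  have -> : piece i != set0.
    have /imsetP[v _ ->] := subsetP CT i iC.
    by apply/set0Pn; exists v; rewrite inE.
  move=> /(_ isT) fi; have /card_gt0P[j] : 0 < #|C :&: touched h set0 i|.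
    by apply: leq_trans fi; have := kf i; lia.
  rewrite inE => /andP[jC /touchedP[/eqP]]; case.
  by have /card_le1_eqP := Cl; apply.
have [hU|/existsNP[S /not_implyP[Sk]]] := EM (kconnected_in k h (pieces_union C)).
  exists C; split=> // i S iC Sk iS.
  by apply: leq_trans (hC _ _ iC Sk iS); exact: leq_addr.
move=> /existsNP[A /existsNP[x /existsNP[y]]].
move=> /not_implyP[clA /not_implyP[xU /not_implyP[yU /not_implyP[xA yA]]]].
have [CA0 CAr] := closed_side hp hC Sk xU xA clA.
have clA' a b : a \in pieces_union C :\: S -> b \in pieces_union C :\: S ->
    h a b -> a \in ~: A -> b \in ~: A.
  move=> aU bU hab; rewrite !inE; apply: contra; apply: clA => //.
  by rewrite h_sym.
have yA' : y \in ~: A by rewrite inE; apply/negP.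
have [CB0 CBr] := closed_side hp hC Sk yU yA' clA'.
move: CA0 CAr CB0 CBr; set CA := [set i in C | _]; set CB := [set i in C | _].
move=> CA0 CAr CB0 CBr.
have sA : CA \subset C by apply/subsetP => i; rewrite inE => /andP[].
have sB : CB \subset C by apply/subsetP => i; rewrite inE => /andP[].
have CAB : CA :&: CB = set0.
  apply/setP => i; rewrite !inE; apply/negP.
  case/andP=> /and3P[iC /subsetP iA _] /and3P[_ /subsetP iB _].
  have /imsetP[v _ iv] := subsetP CT i iC.
  have vi : v \in piece i by rewrite inE iv.
  by have := iB v vi; rewrite inE iA.
have cAB : #|CA| + #|CB| <= #|C|.
  rewrite -cardsUI CAB cards0 addn0 subset_leq_card //.
  by rewrite subUset sA.
have [Al|Al] := leqP #|CA| (2 ^ l).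
  have [C' [C'A C'0 C'r C'k]] := IH CA CA0 (subset_trans sA CT) Al CAr.
  by exists C'; split=> //; exact: subset_trans C'A sA.
have Bl : #|CB| <= 2 ^ l by move: Cl; rewrite expnS; lia.
have [C' [C'B C'0 C'r C'k]] := IH CB CB0 (subset_trans sB CT) Bl CBr.
by exists C'; split=> //; exact: subset_trans C'B sB.
Qed.

End Pieces.

(** * Colourings, flips and merging *)

Section Colourings.
Variables (T : finType) (e : rel T) (k s : nat).
Hypotheses (e_sym : symmetric e) (e_irr : irreflexive e).
Hypotheses (k_gt0 : 0 < k) (s_gt1 : 1 < s).
Implicit Types (c : T -> bool) (p : T -> T) (S C : {set T}).

Definition bichromatic c : rel T := [rel x y | e x y && (c x != c y)].

Definition labels p := [set p v | v : T].

Definition flip c p (x : T -> bool) v := c v (+) x (p v).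

Definition good c p := forall i,
  kconnected_in k (bichromatic c) (piece p i) /\
  (#|piece p i| <= 1 \/ s <= #|piece p i|).

Lemma bichromatic_sym c : symmetric (bichromatic c).
Proof. by move=> x y; rewrite /bichromatic /= e_sym eq_sym. Qed.

Lemma good_flip c p x i : good c p ->
  kconnected_in k (bichromatic (flip c p x)) (piece p i).
Proof.
move=> /(_ i)[+ _]; apply: kconnected_in_eq => u v.
rewrite /bichromatic /flip !inE /= => /eqP-> /eqP->.
by case: (e u v) (c u) (c v) (x i) => -[] [] [].
Qed.

Lemma good_merge c p x C : good c p -> C \subset labels p -> 1 < #|C| ->
  kconnected_in k (bichromatic (flip c p x)) (pieces_union p C) ->
  s <= #|pieces_union p C| ->
  exists c' p', good c' p' /\ #|labels p'| < #|labels p|.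
Proof.
move=> cp CT /card_gt1P[i0 [i1 [i0C i1C i01]]] Ck Cs.
(* The merged piece takes the label [i0], so [i1] disappears from the labels. *)
pose p' v := if p v \in C then i0 else p v.
exists (flip c p x), p'; split; last first.
  apply: proper_card; rewrite properE; apply/andP; split.
    apply/subsetP => _ /imsetP[v _ ->]; rewrite /p'; case: ifP => _.
      exact: (subsetP CT).
    by apply/imsetP; exists v.
  apply/subsetPn; exists i1; first exact: (subsetP CT).
  apply/imsetP => -[v _]; rewrite /p'; case: ifP => [_ i10|pvC i1v].
    by rewrite i10 eqxx in i01.
  by rewrite -i1v i1C in pvC.
move=> i; have [->|ii0] := eqVneq i i0.
  have -> : piece p' i0 = pieces_union p C.
    apply/setP => v; rewrite !inE /p'; case: ifP => [_|pvC]; first by rewrite eqxx.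
    by apply/negbTE/eqP => pvi; rewrite pvi i0C in pvC.
  by split=> //; right.
have [iC|iC] := boolP (i \in C).
  have -> : piece p' i = set0.
    apply/setP => v; rewrite !inE /p'; case: ifP => [_|pvC].
      by rewrite eq_sym (negbTE ii0).
    by apply/negbTE/eqP => pvi; rewrite pvi iC in pvC.
  by rewrite cards0; split; [apply: kconnected_in_le1; rewrite cards0|left].
have -> : piece p' i = piece p i.
  apply/setP => v; rewrite !inE /p'; case: ifP => // pvC.
  rewrite eq_sym (negbTE ii0); apply/esym/negbTE/eqP => pvi.
  by rewrite -pvi pvC in iC.
by split; [exact: good_flip|case: (cp i)].
Qed.

(** * Adjacency of pieces when their number is minimal *)

Section Minimal.
Variables (K : nat) (c : T -> bool) (p : T -> T).
Hypotheses (e_conn : kconnected K e) (sK : s + 2 * k < K).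
Hypotheses (cp : good c p) (p_gt1 : 1 < #|labels p|).
Hypothesis (p_min : forall c' p', good c' p' -> #|labels p| <= #|labels p'|).

Lemma large_label i : 0 < #|piece p i| -> i \in labels p.
Proof. by move=> /card_gt0P[v]; rewrite inE => /eqP <-; apply/imsetP; exists v. Qed.

(* Merging the two pieces, with or without flipping the second one, must fail;
   each failure yields a cover of the edges of one colour pattern. *)
Lemma large_edge_cover i j : i != j -> s <= #|piece p i| -> j \in labels p ->
  exists C, [/\ #|C| <= 2 * k,
    forall u w, p u = i -> p w = j -> e u w -> (u \in C) || (w \in C) &
    forall v, p v = j -> #|piece p j| <= 1 -> v \notin C].
Proof.
move=> ij is_ jl.
have il : i \in labels p by apply: large_label; exact: leq_trans (ltnW s_gt1) is_.
pose x b v := (v == j) && b.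
have bad b : exists S, [/\ #|S| < k, ~~ (piece p j \subset S) &
    forall u w, p u = i -> p w = j -> bichromatic (flip c p (x b)) u w ->
      (u \in S) || (w \in S)].
  apply: contrapT => noS.
  have U : pieces_union p [set i; j] = piece p i :|: piece p j.
    by apply/setP => v; rewrite !inE.
  have : kconnected_in k (bichromatic (flip c p (x b))) (pieces_union p [set i; j]).
    rewrite U; apply: kconnected_inU; try exact: good_flip.
      exact: bichromatic_sym.
    move=> S Sk iS jS; apply: contrapT => noE; apply: noS; exists S; split=> //.
    move=> u w pu pw uw; apply/negPn; rewrite negb_or; apply/negP => /andP[uS wS].
    by apply: noE; exists u, w; rewrite !inE uS wS pu pw !eqxx.
  move=> /(good_merge cp); case.
  - by apply/subsetP => v; rewrite !inE => /orP[] /eqP->.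
  - by rewrite cards2 ij.
  - by rewrite U (leq_trans is_) // subset_leq_card ?subsetUl.
  by move=> c' [p' [/p_min]]; rewrite leqNgt => /negP.
have [S0 [S0k jS0 S0E]] := bad false; have [S1 [S1k jS1 S1E]] := bad true.
exists (S0 :|: S1); split.
- by apply: leq_trans (leq_card_setU _ _) _; lia.
- move=> u w pu pw euw; have := S0E u w pu pw; have := S1E u w pu pw.
  rewrite /bichromatic /= /flip /x pu pw euw (negbTE ij) eqxx.
  rewrite !andbT !andbF !addbF addbT !inE.
  (* Exactly one of the two flips makes the edge bichromatic, and the matching separator then meets
     it. *)
  by case: (c u); case: (c w) => /= H1 H0;
    first [case/orP: (H1 isT) | case/orP: (H0 isT)] => ->; rewrite ?orbT.
- move=> v pv j1.
  have vS S : ~~ (piece p j \subset S) -> v \notin S.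
    move=> /subsetPn[w wj wS]; suff -> : v = w by [].
    by move/card_le1_eqP: j1; apply => //; rewrite inE pv.
  by rewrite inE negb_or !vS.
Qed.

Lemma edge_cover i j : i != j -> exists C, #|C| <= 2 * k /\
  forall u w, p u = i -> p w = j -> e u w -> (u \in C) || (w \in C).
Proof.
move=> ij; have [[_ [i1|is_]] [_ [j1|js]]] := (cp i, cp j); last first.
- have [|C [? ? _]] := large_edge_cover ij is_; last by exists C.
  by apply: large_label; exact: leq_trans (ltnW s_gt1) js.
all: try (exists (piece p j); split=> [|u w _ pw _];
  [by apply: leq_trans j1 _; lia|by rewrite !inE pw eqxx orbT]).
exists (piece p i); split=> [|u w pu _ _]; first by apply: leq_trans i1 _; lia.
by rewrite inE pu eqxx.
Qed.

(** For a large piece [j], the edge cover can avoid [v], so it contains all neighbours of [v] in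
    that piece. *)
Lemma small_degree v j : #|piece p (p v)| <= 1 -> j != p v ->
  #|[set w | (p w == j) && e v w]| <= 2 * k.
Proof.
move=> v1 jv; have [_ [j1|js]] := cp j.
  apply: leq_trans (_ : #|piece p j| <= _); last by apply: leq_trans j1 _; lia.
  by apply/subset_leq_card/subsetP => w; rewrite !inE => /andP[].
have [|C [Ck CE Cv]] := large_edge_cover jv js; first by apply/imsetP; exists v.
apply: leq_trans (subset_leq_card _) Ck; apply/subsetP => w.
rewrite inE => /andP[/eqP pw evw]; have := CE w v pw erefl.
by rewrite e_sym evw (negbTE (Cv v erefl v1)) orbF; apply.
Qed.

(** The single vertex has degree at least [K], and each other piece absorbs at most [2 * k] of
    it. *)
Lemma touched_small i S : #|piece p i| <= 1 -> ~~ (piece p i \subset S) ->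
  K <= #|touched p e S i| * (2 * k).
Proof.
move=> i1 /subsetPn[v]; rewrite inE => /eqP pv vS; move: i1; rewrite -pv => v1.
apply: leq_trans (kconnected_degree v e_irr e_conn) _.
apply: (@leq_trans #|\bigcup_(j in touched p e S (p v))
                       [set w | (p w == j) && e v w]|).
  apply/subset_leq_card/subsetP => w; rewrite inE => evw.
  apply/bigcupP; exists (p w); last by rewrite inE eqxx.
  apply/touchedP; split; last by exists v, w.
  apply: contraTneq evw => pwv; suff -> : w = v by rewrite e_irr.
  by move/card_le1_eqP: v1; apply; rewrite inE ?pwv.
by apply: leq_card_bigcup => j /touchedP[jv _]; exact: small_degree.
Qed.

(** Otherwise [S] and the covers towards the touched pieces form a set [D] of fewer than [s]
    vertices, whose deletion leaves no edge out of piece [i]. Either [D] is a cut smaller than [K],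
    or it contains everything outside the piece. *)
Lemma touched_large i S : s <= #|piece p i| -> #|S| < k ->
  s <= #|touched p e S i| * (2 * k) + k.
Proof.
move=> is_ Sk; rewrite leqNgt; apply/negP => ts.
pose covers j (C : {set T}) := i != j -> #|C| <= 2 * k /\
    forall u w, p u = i -> p w = j -> e u w -> (u \in C) || (w \in C).
have : forall j, exists C, covers j C.
  move=> j; have [ij|ij] := eqVneq i j; first by exists set0; rewrite /covers ij eqxx.
  by have [C CP] := edge_cover ij; exists C.
move=> /choice[F FP].
pose C := \bigcup_(j in touched p e S i) F j; pose D := C :|: S.
have Ds : #|D| < s.
  apply: leq_ltn_trans (leq_card_setU _ _) _; apply: leq_ltn_trans ts.
  rewrite leq_add //; last exact: ltnW.
  by apply: leq_card_bigcup => j /touchedP[ji _]; have [] := FP j _; rewrite 1?eq_sym.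
have /subsetPn[x xi xD] : ~~ (piece p i \subset D).
  by apply/negP => /subset_leq_card; lia.
have [iD|/subsetPn[y]] := boolP (~: piece p i \subset D); last first.
  rewrite inE => yi yD; have : K <= #|D|; last by lia.
  apply: (kconnected_cut e_conn xD yD xi yi) => a b aD bD eab.
  rewrite !inE => /eqP pa; apply: contraT => pbi.
  have bt : p b \in touched p e S i.
    apply/touchedP; split=> //; exists a, b; split=> //.
    by apply: contra aD; rewrite inE => ->; rewrite orbT.
  have ipb : i != p b by rewrite eq_sym.
  have [_ /(_ a b pa erefl eab)/orP ab] := FP (p b) ipb.
  have FC : F (p b) \subset D.
    by apply: subset_trans (subsetUl _ _); exact: bigcup_sup.
  by case: ab => /(subsetP FC) ab; [rewrite ab in aD|rewrite ab in bD].
have [j0 [j1 [/imsetP[v0 _ jv0] /imsetP[v1 _ jv1] j01]]] := card_gt1P p_gt1.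
have [v iv] : exists v, p v != i.
  have [v0i|] := eqVneq (p v0) i; last by exists v0.
  by exists v1; rewrite -v0i -jv0 -jv1 eq_sym.
(* Being inside [D], the piece of [v] is not large. So [v] has at most [2 * k] neighbours in piece
   [i] and the rest in [D], fewer than [K] in all. *)
have v1' : #|piece p (p v)| <= 1.
  have [_ [//|]] := cp (p v); have : #|piece p (p v)| <= #|D|; last by lia.
  apply: leq_trans (subset_leq_card iD); apply/subset_leq_card/subsetP => w.
  by rewrite !inE => /eqP->.
have := kconnected_degree v e_irr e_conn.
have : #|[set y | e v y]| <= #|[set w | (p w == i) && e v w] :|: D|.
  apply/subset_leq_card/subsetP => w; rewrite !inE => ->; rewrite andbT.
  have [//|wi] := boolP (p w == i).
  by have := subsetP iD w; rewrite !inE; apply.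
have [+ _] := leq_card_setU [set w | (p w == i) && e v w] D.
have : #|[set w | (p w == i) && e v w]| <= 2 * k.
  by apply: small_degree => //; rewrite eq_sym.
by lia.
Qed.

End Minimal.
End Colourings.

(** * Random flips and descent on the number of pieces *)

Lemma set_of_option_ffun (T : finType) k (S : {set T}) : #|S| <= k ->
  exists f : {ffun 'I_k -> option T}, S = [set v | Some v \in codom f].
Proof.
move=> Sk; exists [ffun i : 'I_k => onth (enum S) i]; apply/setP => v.
rewrite inE; apply/idP/codomP => [vS|[i]].
  have vk : index v (enum S) < k.
    by apply: leq_trans Sk; rewrite cardE index_mem mem_enum.
  exists (Ordinal vk); rewrite ffunE /= onthE (nth_map v) ?nth_index ?mem_enum //.
  by rewrite index_mem mem_enum.
by rewrite ffunE -mem_enum => iv; apply/onthP; exists i.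
Qed.

Section Extension.
Variables (T : finType) (e : rel T) (k L K : nat).
Hypotheses (e_sym : symmetric e) (e_irr : irreflexive e).
Hypotheses (k_gt0 : 0 < k) (L_gt0 : 0 < L) (T_L : #|T| <= 2 ^ L).
Hypotheses (e_conn : kconnected K e) (K_ge : 2000 * k ^ 3 * L <= K).

Let s := 100 * k ^ 2 * L.

(* The factor [4 ^ (6 * k * L)] has to beat the number of triples formed by a
   label, a set of at most [k] vertices and the colour shift of that label. *)
Lemma rich_flip c p :
  (forall i (S : {set T}), #|piece p i| <= 1 -> ~~ (piece p i \subset S) ->
    K <= #|touched p e S i| * (2 * k)) ->
  (forall i (S : {set T}), s <= #|piece p i| -> #|S| < k ->
    s <= #|touched p e S i| * (2 * k) + k) ->
  good e k s c p ->
  exists x, rich p k (bichromatic e (flip c p x)) (labels p)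
    (fun i => (if #|piece p i| <= 1 then s else 5 * k * L) + k * L).
Proof.
move=> small large cp.
(* Functions into [option T] index the sets of at most [k] vertices, [None] serving as padding. The
   boolean in [J] guesses [x i], because the target values may not depend on [x]. *)
pose Sf (f : {ffun 'I_k -> option T}) := [set v | Some v \in codom f].
pose J := (T * {ffun 'I_k -> option T} * bool)%type.
have : forall t : {set T} * T * T, exists y : bool,
    t.2 \in touched p e t.1.1 t.1.2 ->
    exists u w,
      [/\ p u = t.1.2, u \notin t.1.1, p w = t.2, e u w & y = c u (+) c w].
  move=> [[S i] j] /=.
  have [/touchedP[_ [u [w [pu uS pw euw]]]]|] := boolP (_ \in _).
    by exists (c u (+) c w) => _; exists u, w.
  by exists true.
move=> /choice[g gP].
pose N (t : J) := touched p e (Sf t.1.2) t.1.1.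
(* The value of [x j] that makes the chosen edge bichromatic when [x i] is [t.2]. *)
pose b (t : J) j := ~~ (g (Sf t.1.2, t.1.1, j) (+) t.2).
pose d (t : J) := (if #|piece p t.1.1| <= 1 then s else 5 * k * L) + k * L.
have JD : #|{: J}| < 4 ^ (6 * k * L).
  rewrite !card_prod card_ffun card_option card_ord card_bool.
  have TL : #|T|.+1 <= 2 ^ L.+1 by rewrite expnS; have := expn_gt0 2 L; lia.
  have h1 := leq_expl k TL.
  apply: (@leq_ltn_trans (2 ^ L * (2 ^ L.+1) ^ k * 2)); first by rewrite !leq_mul.
  by rewrite -expnM -expnD -expnSr -[4]/(2 ^ 2) -(expnM 2 2) ltn_exp2l //; nia.
have [x xP] := exists_many_matches N b d JD; exists x => i S il Sk iS.
have [f Sf_S] : exists f, S = Sf f := set_of_option_ffun (ltnW Sk).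
have := xP (i, f, x i); rewrite /N /d /= -Sf_S => {}xP.
have : 6 * k * L <= (if #|piece p i| <= 1 then s else 5 * k * L) + k * L.
  by rewrite /s; case: ifP => _; nia.
move=> /xP{}xP; apply: leq_trans (xP _) _.
  (* A large piece touches at least [50 * k * L] others and needs [48 * k * L]; a single vertex
     touches at least [1000 * k ^ 2 * L] and needs [8 * (s + k * L)]. *)
  case: (ltnP 1 #|piece p i|) => i1.
    have is_ : s <= #|piece p i| by have [_ []] := cp i; lia.
    by have := large i S is_ Sk; rewrite /s; nia.
  have := small i S i1 iS; move: K_ge; rewrite /s; nia.
apply/subset_leq_card/subsetP => j; rewrite !inE => /andP[/andP[ji jt]].
have {jt}/gP[u [w /= [pu uS pw euw gE]]] : (S, i, j).2 \in touched p e S i.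
  by rewrite inE ji.
rewrite /b /= -Sf_S gE => /eqP xj.
rewrite ji; apply/andP; split; first by apply/imsetP; exists w.
apply/existsP; exists u; apply/existsP; exists w; rewrite pu pw !eqxx uS /=.
rewrite /bichromatic /= euw /flip pu pw xj.
by case: (c u) (c w) (x i) => [] [] [].
Qed.

Lemma good_fewer_labels c p : good e k s c p -> 1 < #|labels p| ->
  exists c' p', good e k s c' p' /\ #|labels p'| < #|labels p|.
Proof.
move=> cp p_gt1; apply: contrapT => p_min'.
have p_min c' p' : good e k s c' p' -> #|labels p| <= #|labels p'|.
  by move=> cp'; rewrite leqNgt; apply/negP => lt; apply: p_min'; exists c', p'.
have s_gt1 : 1 < s by rewrite /s; nia.
have sK : s + 2 * k < K by move: K_ge; rewrite /s; nia.
have [||x xr] := rich_flip _ _ cp.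
- move=> i S.
  by apply: (touched_small e_sym e_irr k_gt0 s_gt1 e_conn sK cp p_gt1 p_min).
- move=> i S.
  by apply: (touched_large e_sym e_irr k_gt0 s_gt1 e_conn sK cp p_gt1 p_min).
have [||||||C [Cl C0 Cr Ck]] := kconnected_subfamily _ k_gt0 _ _ _ _ _ xr.
- exact: bichromatic_sym.
- by move=> i; exact: good_flip.
- by rewrite -card_gt0; exact: ltnW.
- by [].
- by apply: leq_trans T_L; rewrite max_card.
- by move=> i; rewrite /s; case: ifP => _; nia.
have piece0 i : i \in C -> ~~ (piece p i \subset set0).
  move=> /(subsetP Cl)/imsetP[v _ ->]; rewrite subset0.
  by apply/set0Pn; exists v; rewrite inE.
have k0 : #|set0 : {set T}| < k by rewrite cards0.
have {}Cr i (iC : i \in C) := Cr i set0 iC k0 (piece0 i iC).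
have C_gt1 : 1 < #|C|.
  have /set0Pn[i iC] := C0; have := Cr i iC; set m := (if _ then _ else _) => mC.
  have /card_gt0P[j] : 0 < #|C :&: touched p (bichromatic e (flip c p x)) set0 i|.
    apply: leq_trans mC; rewrite /m; case: ifP => _; first exact: ltnW.
    by nia.
  rewrite inE => /andP[jC /touchedP[ji _]].
  by apply/card_gt1P; exists i, j; rewrite eq_sym.
apply: p_min'; apply: (good_merge cp Cl C_gt1 Ck).
(* Without a large piece, all members are single vertices, and richness alone forces at least [s] of
   them. *)
have [/existsP[i /andP[iC is_]]|/existsPn small] :=
    boolP [exists i, (i \in C) && (s <= #|piece p i|)].
  apply: leq_trans is_ _; apply/subset_leq_card/subsetP => v.
  by rewrite !inE => /eqP->.
have /set0Pn[i iC] := C0; have := Cr i iC.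
have -> : #|piece p i| <= 1.
  by have := small i; rewrite iC /=; have [_ []] := cp i => // ->.
move=> sC; apply: leq_trans sC _; apply: (@leq_trans #|C|).
  by rewrite subset_leq_card ?subsetIl.
apply: leq_trans (leq_imset_card p (pieces_union p C)).
apply/subset_leq_card/subsetP => j jC.
have /imsetP[v _ jv] := subsetP Cl j jC.
by apply/imsetP; exists v; rewrite // inE -jv.
Qed.

(** Descent from the partition into single vertices, until one piece is left. *)
Lemma exists_kconnected_bichromatic : 1 < #|T| ->
  exists c : T -> bool, kconnected k (bichromatic e c).
Proof.
move=> T1.
have [c [p [cp p1]]] : exists c p, good e k s c p /\ #|labels p| <= 1.
  have : good e k s (fun=> true) id.
    move=> i; have i1 : #|piece id i| <= 1.
      apply/card_le1_eqP => u v; rewrite !inE => /eqP-> /eqP->.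
      by [].
    by split; [exact: kconnected_in_le1|left].
  have [m] := ubnP #|labels (T := T) id|.
  elim: m (fun=> true) id => // m IH c p pm cp.
  have [p1|p1] := leqP #|labels p| 1; first by exists c, p.
  have [c' [p' [cp' lt]]] := good_fewer_labels cp p1.
  by apply: (IH c' p' _ cp'); lia.
have /card_gt0P[v _] := ltnW T1.
have pT : piece p (p v) = setT.
  apply/setP => w; rewrite !inE; apply/eqP.
  by apply: (card_le1_eqP p1); rewrite imset_f.
exists c; have [ck cs] := cp (p v); rewrite pT cardsT in ck cs.
(* As [#|T|] exceeds 1, the piece is large, and [s] exceeds [k]. *)
apply: kconnected_in_setT ck; move: cs; rewrite /s; nia.
Qed.

End Extension.

(** * Logarithms and the final constant *)

Import Order.TTheory GRing.Theory Num.Theory.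

Lemma log2_ge (R : realType) (m n : nat) : 2 ^ m <= n ->
  (m%:R <= log2 n%:R :> R)%R.
Proof.
move=> mn; have n_gt0 : 0 < n by apply: leq_trans mn; rewrite expn_gt0.
rewrite /log2 ler_pdivlMr ?ln_gt0 ?ltr1n // mulr_natl -lnXn // -natrX.
by rewrite ler_ln ?posrE ?ltr0n ?expn_gt0 // ler_nat.
Qed.

(** Rounding up adds at most 1, and [log2 n] is at least 1. *)
Lemma up_log2_le (R : realType) n : 1 < n ->
  ((up_log 2 n)%:R <= 2 * log2 n%:R :> R)%R.
Proof.
move=> n_gt1; have /ltnW/(log2_ge R) h := up_log_gtn (isT : 1 < 2) n_gt1.
have /(log2_ge R) h1 : 2 ^ 1 <= n by [].
have -> : up_log 2 n = (up_log 2 n).-1 + 1 by have := up_log_gt0 2 n; lia.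
by rewrite natrD mulr_natl mulr2n lerD.
Qed.

(** For [n = 1] the logarithm vanishes, so the degree of connectivity required of [G] is 0, yet no
    [H] has positive [kappa]; hence [1 < n]. *)
Theorem theorem2 (R : realType) (k n : nat) (k_gt0 : 0 < k) (n_gt1 : 1 < n)
    (T : finType) (G : rel T) (G_simple : simple_graph G) (card_T : #|T| = n)
    (kappa_G :
      (10 ^+ 10 * k%:R ^+ 3 * log2 n%:R <= (kappa G)%:R :> R)%R) :
  exists H : rel T,
    [/\ spanning_subgraph H G, bipartite H & k <= kappa H].
Proof.
have [G_sym G_irr] := G_simple.
have T1 : 1 < #|T| by rewrite card_T.
have T0 := ltnW T1.
have [||||c cP] := @exists_kconnected_bichromatic
    T G k (up_log 2 n) (kappa G) G_sym G_irr k_gt0 _ _ _ _ T1.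
- by rewrite up_log_gt0.
- by rewrite card_T up_logP.
- by rewrite kconnected_kappa.
- rewrite -(ler_nat R) (le_trans _ kappa_G) // natrM [(2000 * _)%:R%R]natrM natrX.
  apply: (@le_trans _ _ (2000 * k%:R ^+ 3 * (2 * log2 n%:R))%R).
    by rewrite ler_wpM2l ?up_log2_le // mulr_ge0 ?exprn_ge0.
  rewrite mulrACA -[leRHS]mulrA ler_wpM2r //.
    by rewrite mulr_ge0 ?exprn_ge0 // (le_trans _ (log2_ge R (m := 0) _)) // ltnW.
  (* The constant is 2000 times the factor 2 lost in rounding the logarithm. *)
  rewrite (@le_trans _ _ (10 ^+ 4)%R) ?ler_eXn2l ?ltr1n //.
  by rewrite -natrM -natrX ler_nat.
exists (bichromatic G c); split; last by rewrite -kconnected_kappa.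
- split; last by move=> x y /andP[].
  by split; [exact: bichromatic_sym|move=> x; rewrite /bichromatic /= G_irr].
- by exists [set v | c v] => x y /andP[_]; rewrite !inE.
Qed.
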